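(* (Rogers type formula for $\phi_n^{(\mathbf a,\mathbf b)}(x,y|q)$.) Let $|q|<1$. The following Rogers type formula holds true: $$\sum_{n=0}^\infty\sum_{m=0}^\infty\phi_{n+m}^{(\mathbf a,\mathbf b)}(x,y|q)\,\frac{t^n}{(q;q)_n}\,\frac{s^m}{(q;q)_m}=\frac{1}{(yt,ys;q)_\infty}\sum_{n=0}^\infty\frac{(a_1,a_2,\dots,a_{r+1};q)_n}{(q,b_1,b_2,\dots,b_r;q)_n}\,(xt)^n\;{}_2\Phi_0\!\left[\begin{matrix}q^{-n},\,yt\\ -\end{matrix};q;\frac{sq^n}{t}\right]\qquad(\max\{|yt|,|ys|\}<1).$$
   Context: Notation: $(a;q)_0=1$, $(a;q)_n=\prod_{k=0}^{n-1}(1-aq^k)$, $(a;q)_\infty=\prod_{k=0}^\infty(1-aq^k)$, $(c_1,\dots,c_m;q)_n=(c_1;q)_n\cdots(c_m;q)_n$ (also for $n=\infty$), and $\left[{n\atop k}\right]_q=\frac{(q;q)_n}{(q;q)_k(q;q)_{n-k}}$ is the $q$-binomial coefficient. Basic hypergeometric series: ${}_{u}\Phi_{v}\!\left[\begin{matrix}\alpha_1,\dots,\alpha_{u}\\ \beta_1,\dots,\beta_{v}\end{matrix};q;z\right]=\sum_{k\ge0}\left[(-1)^kq^{\binom k2}\right]^{1+v-u}\frac{(\alpha_1,\dots,\alpha_{u};q)_k}{(\beta_1,\dots,\beta_{v};q)_k}\frac{z^k}{(q;q)_k}$, where $q\neq0$ when $u>v+1$; a dash means that there are no parameters of that kind.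 With parameters $\mathbf a=(a_1,\dots,a_{r+1})$ and $\mathbf b=(b_1,\dots,b_r)$, the generalized Al-Salam-Carlitz $q$-polynomials are $$\phi_n^{(\mathbf a,\mathbf b)}(x,y|q)=\sum_{k=0}^n\left[{n\atop k}\right]_q\frac{(a_1,\dots,a_{r+1};q)_k}{(b_1,\dots,b_r;q)_k}\,x^ky^{n-k}.$$
   Formalization: The printed condition does not make the left series converge (e.g. y=s=0, x=1, t=2, all a_i=b_i=0); the formal statement also assumes |xt|,|xs|<1 or some a_i=q^{-N}, exactly when it converges, and q≠0, t≠0, b_i q^k≠1 so that all terms are defined. *)

(* Defs.v *)
From HB Require Import structures.
From mathcomp Require Import all_boot all_order all_algebra.
From mathcomp Require Import complex.
From mathcomp Require Import all_classical all_reals all_analysis.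

Set Implicit Arguments.
Unset Strict Implicit.
Unset Printing Implicit Defensive.

Import Order.TTheory GRing.Theory Num.Theory.
Import numFieldNormedType.Exports.

Local Open Scope classical_set_scope.
Local Open Scope ring_scope.

(* Declaring the complex numbers at type [numFieldType] gives them the norm
   topology, which is not attached to [R[i]] itself. *)
Definition Cplx (R : realType) : numFieldType := R[i].

Definition qpoch (K : numFieldType) (a q : K) (n : nat) : K :=
  \prod_(k < n) (1 - a * q ^+ k).

Definition qpoch_inf (K : numFieldType) (a q : K) : K :=
  limn (fun n => qpoch a q n).

Definition qpochs (K : numFieldType) (c : seq K) (q : K) (n : nat) : K :=
  \prod_(a <- c) qpoch a q n.

Definition qpochs_inf (K : numFieldType) (c : seq K) (q : K) : K :=
  \prod_(a <- c) qpoch_inf a q.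

Definition qbinom (K : numFieldType) (q : K) (n k : nat) : K :=
  qpoch q q n / (qpoch q q k * qpoch q q (n - k)).

(* The exponent [1 + v - u] is an integer, negative when [u > v + 1]. *)
Definition qhyper_term (K : numFieldType) (al be : seq K) (q z : K) (k : nat)
    : K :=
  ((-1) ^+ k * q ^+ 'C(k, 2)) ^ (1 + (size be)%:Z - (size al)%:Z)
  * (qpochs al q k / qpochs be q k) * (z ^+ k / qpoch q q k).

Definition qhyper (K : numFieldType) (al be : seq K) (q z : K) : K :=
  limn (series (qhyper_term al be q z)).

Definition al_salam_carlitz (K : numFieldType) (r : nat) (a : r.+1.-tuple K)
    (b : r.-tuple K) (q : K) (n : nat) (x y : K) : K :=
  \sum_(k < n.+1)
    qbinom q n k * (qpochs a q k / qpochs b q k) * x ^+ k * y ^+ (n - k).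

(* Main.v *)
Require Import Defs.
From HB Require Import structures.
From mathcomp Require Import all_boot all_order all_algebra.
From mathcomp Require Import complex.
From mathcomp Require Import all_classical all_reals all_analysis.
From mathcomp Require Import ring lra zify.
Import Order.TTheory GRing.Theory Num.Theory.
Import numFieldNormedType.Exports.
Local Open Scope classical_set_scope.
Local Open Scope ring_scope.

(** Write [c_k] for the ratio of the shifted factorials of [a] and [b], and
    [e_k(z) = z^k / (q;q)_k], whose sum over [k] is Euler's q-exponential
    [E(z) = 1 / (z;q)_oo] ([qpoch_infE]).

    The q-Vandermonde identity [qbinom_vandermonde], used with the index
    [n + m], breaks every term of the double series into products:
      [phi_{n+m} t^n/(q)_n s^m/(q)_m
         = sum_(i <= n, j <= m) u(i, j, n - i) e_{m-j}(ys)],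
      [u(i, j, l) = c_{i+j} e_i(xt) e_j(xs) q^(jl) e_l(yt)]
    ([al_salam_carlitz_rogers_row]).  The sum over [m] is therefore a Cauchy
    product which splits off the factor [E(ys)], and the sum over [n] runs along
    the antidiagonals [i + l = n] of the remaining triple series.  Summing that
    triple series over [l] first gives
    [E(yt q^j) = (yt;q)_j E(yt)], which splits off [E(yt)] and leaves the double
    series of [c_{i+j} e_i(xt) e_j(xs) (yt;q)_j].  Its antidiagonals [i + j = n]
    are the terms of the right-hand side, since the series 2Phi0 there
    terminates and equals the sum over [k] of
    [qbinom n k (yt;q)_k (s/t)^k] ([qhyper20_qV], [rogers_diag_qhyper]).

    The rearrangements ([rogers_summation]) are legitimate because
    [|u(i, j, l)| <= D rho^i rho^j |yt|^l] for some [rho < 1]: either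
    [|xt|, |xs| < 1], or [c] has finite support and any positive
    [rho] will do.  They
    rest on Tannery's theorem ([tannery]), from which the summation by
    antidiagonals and the exchange of two sums follow. *)

Set Implicit Arguments.
Unset Strict Implicit.
Unset Printing Implicit Defensive.

(** * The real modulus of a complex number *)

(** The norm of [Cplx R] is itself a complex number; its real-valued version
    gives access to limits, suprema and linear arithmetic in [R]. *)
Definition cmod (R : realType) (z : Cplx R) : R := complex.Re `|z|.

Section Modulus.
Variable R : realType.
Implicit Types z w : Cplx R.

Lemma cmodE z : `|z| = (real_complex R (cmod z) : Cplx R).
Proof. by apply/esym/(@RRe_real R)/(@normr_real _ (Cplx R)). Qed.

Lemma cmod_ge0 z : 0 <= cmod z.
Proof. by rewrite -lecR -cmodE normr_ge0. Qed.

Lemma cmod_lt z (e : R) : (`|z| < (real_complex R e : Cplx R)) = (cmod z < e).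
Proof. by rewrite cmodE ltcR. Qed.

Lemma cmod_lt1 z : (`|z| < 1) = (cmod z < 1).
Proof. by rewrite -cmod_lt rmorph1. Qed.

Lemma cmodM z w : cmod (z * w) = cmod z * cmod w.
Proof.
by apply: (@complexI R); rewrite rmorphM /= -!cmodE; exact: (@normrM (Cplx R)).
Qed.

Lemma cmod1 : cmod (1 : Cplx R) = 1.
Proof.
by apply: (@complexI R); rewrite -cmodE rmorph1;
  exact: (@normr1 (Cplx R)).
Qed.

Lemma cmod0 : cmod (0 : Cplx R) = 0.
Proof.
by apply: (@complexI R); rewrite -cmodE rmorph0;
  exact: (@normr0 _ (Cplx R)).
Qed.

Lemma cmodN z : cmod (- z) = cmod z.
Proof. by rewrite /cmod normrN. Qed.

Lemma cmodX z n : cmod (z ^+ n) = cmod z ^+ n.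
Proof.
by apply: (@complexI R); rewrite rmorphXn /= -!cmodE; exact: (@normrX (Cplx R)).
Qed.

Lemma ler_cmodD z w : cmod (z + w) <= cmod z + cmod w.
Proof. by rewrite -lecR rmorphD /= -!cmodE; exact: (@ler_normD _ (Cplx R)). Qed.

Lemma ler_cmod_sum I (s : seq I) (P : pred I) (f : I -> Cplx R) :
  cmod (\sum_(i <- s | P i) f i) <= \sum_(i <- s | P i) cmod (f i).
Proof.
elim/big_ind2 : _ => [|z a w b za wb|//]; first by rewrite cmod0.
exact: (le_trans (ler_cmodD _ _) (lerD za wb)).
Qed.

Lemma cvg_cmodP (u : nat -> Cplx R) (l : Cplx R) :
  (u @ \oo --> l) <-> ((fun n => cmod (l - u n)) @ \oo --> (0 : R)).
Proof.
split=> [/cvgrPdist_lt ul|/cvgr0Pnorm_lt ul].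
  apply/cvgr0Pnorm_lt => e e0; have := ul (real_complex R e).
  rewrite ltcR => /(_ e0); apply: filterS => n.
  by rewrite cmod_lt ger0_norm ?cmod_ge0.
apply/cvgrPdist_lt => e e0.
have eE : e = (real_complex R (complex.Re e) : Cplx R).
  by apply/esym/(@RRe_real R)/gtr0_real.
move: e0; rewrite eE ltcR => e0; have := ul _ e0; apply: filterS => n.
by rewrite cmod_lt ger0_norm ?cmod_ge0.
Qed.

Lemma cvg_cmod (u : nat -> Cplx R) (l : Cplx R) :
  u @ \oo --> l -> (fun n => cmod (u n)) @ \oo --> cmod l.
Proof.
move=> /cvg_cmodP/cvgr0Pnorm_lt ul; apply/cvgrPdist_lt => e /ul.
apply: filterS => n; rewrite ger0_norm ?cmod_ge0 //.
apply: le_lt_trans; rewrite ler_norml lerBrDr lerBlDr.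
apply/andP; split.
  rewrite addrC lerBlDr; have := ler_cmodD (u n - l) l.
  by rewrite subrK -[u n - l]opprB cmodN addrC.
by have := ler_cmodD (l - u n) (u n); rewrite subrK.
Qed.

End Modulus.

(** * Convergence of series *)

Lemma cvg_series_finite (K : numFieldType) (u : nat -> K) N :
  (forall k, (N <= k)%N -> u k = 0) ->
  series u @ \oo --> \sum_(k < N) u k.
Proof.
move=> u0; apply: cvg_near_cst; near=> n.
have Nn : (N <= n)%N by near: n; exact: nbhs_infty_ge.
rewrite /series /= (big_cat_nat (n := N)) //= big_mkord.
rewrite [X in _ + X]big1_seq ?addr0 //.
by move=> k /andP[_]; rewrite mem_index_iota => /andP[Nk _]; exact: u0.
Unshelve. all: by end_near. Qed.

Section Series.
Variable R : realType.
Implicit Types (u v : nat -> Cplx R) (M : nat -> R).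

Lemma cmod_sqrt (z : Cplx R) :
  cmod z = Num.sqrt (complex.Re z ^+ 2 + complex.Im z ^+ 2).
Proof. by apply: (@complexI R); rewrite -cmodE; exact: (@normc_def R). Qed.

(** Completeness of the complex numbers enters only here: the real and imaginary
    parts are dominated by the modulus, hence are convergent real series. *)
Lemma abs_summable_cvg u M :
  (forall k, cmod (u k) <= M k) -> cvgn (series M) -> cvgn (series u).
Proof.
move=> uM cM.
have M0 k : 0 <= M k by exact: le_trans (cmod_ge0 _) (uM k).
have real_part (p : Cplx R -> R) : (forall z, `|p z| <= cmod z) ->
    cvgn (series (p \o u)).
  move=> pz; apply: normed_cvg.
  apply: (series_le_cvg (v_ := M)) => //= k.
  exact: le_trans (pz _) (uM k).
have cre : cvgn (series ((fun z : Cplx R => complex.Re z) \o u)).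
  apply: (real_part (fun z => complex.Re z)) => z; rewrite cmod_sqrt -sqrtr_sqr.
  by rewrite ler_wsqrtr // lerDl sqr_ge0.
have cim : cvgn (series ((fun z : Cplx R => complex.Im z) \o u)).
  apply: (real_part (fun z => complex.Im z)) => z; rewrite cmod_sqrt -sqrtr_sqr.
  by rewrite ler_wsqrtr // lerDr sqr_ge0.
set a := limn _ in cre; set b := limn _ in cim.
apply/cvg_ex; exists (Complex a b : Cplx R); apply/cvg_cmodP.
have seriesE n : series u n =
    Complex (series ((fun z : Cplx R => complex.Re z) \o u) n)
            (series ((fun z : Cplx R => complex.Im z) \o u) n) :> Cplx R.
  elim: n => [|n IHn]; first by rewrite /series /= !big_geq.
  by rewrite !seriesSr IHn /=; case: (u n).
have bound (z : Cplx R) : cmod z <= `|complex.Re z| + `|complex.Im z|.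
  rewrite cmod_sqrt -(ler_pXn2r (ltn0Sn 1)) ?nnegrE ?sqrtr_ge0 ?addr_ge0 //.
  rewrite sqr_sqrtr ?addr_ge0 ?sqr_ge0 // sqrrD !real_normK ?num_real //.
  rewrite lerD2r lerDl.
  by rewrite mulrn_wge0 // mulr_ge0.
apply: (@squeeze_cvgr _ _ _ _ (fun=> 0) (fun n =>
    `|a - series ((fun z : Cplx R => complex.Re z) \o u) n| +
    `|b - series ((fun z : Cplx R => complex.Im z) \o u) n|)).
- near=> n; rewrite cmod_ge0 /=; apply: le_trans (bound _) _.
  by rewrite seriesE.
- exact: cvg_cst.
rewrite -[0 in X in _ --> X]addr0; apply: cvgD.
  rewrite -(normr0 R) -(subrr a); apply: cvg_norm.
  by apply: cvgB => //; exact: cvg_cst.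
rewrite -(normr0 R) -(subrr b); apply: cvg_norm.
by apply: cvgB => //; exact: cvg_cst.
Unshelve. all: by end_near. Qed.

Lemma nondecreasing_nonneg_series M : (forall k, 0 <= M k) ->
  {homo series M : n m / (n <= m)%N >-> n <= m}.
Proof. by move=> M0; apply: nondecreasing_series. Qed.

Lemma cmod_lim_le u (l : Cplx R) (x : R) N : u @ \oo --> l ->
  (forall n, (N <= n)%N -> cmod (u n) <= x) -> cmod l <= x.
Proof.
move=> /cvg_cmod ul ux; apply: (cvgr_to_le ul).
by exists N => // n; exact: ux.
Qed.

Lemma cmod_sum_le u M (S : Cplx R) : (forall k, cmod (u k) <= M k) ->
  cvgn (series M) -> series u @ \oo --> S -> cmod S <= limn (series M).
Proof.
move=> uM cM uS; apply: (cmod_lim_le (N := 0%N) uS) => n _.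
apply: le_trans (ler_cmod_sum _ _ _) _.
apply: le_trans (ler_sum _ (fun k _ => uM k)) _.
apply: nondecreasing_cvgn_le => //; apply: nondecreasing_nonneg_series => k.
exact: le_trans (cmod_ge0 _) (uM k).
Qed.

End Series.

(** * q-binomial identities *)

Section FiniteIdentities.
Variables (K : numFieldType) (q : K).
Implicit Types (a b w : K) (g : nat -> K).

Lemma qpoch0 a : qpoch a q 0 = 1.
Proof. by rewrite /qpoch big_ord0. Qed.

Lemma qpochS a n : qpoch a q n.+1 = qpoch a q n * (1 - a * q ^+ n).
Proof. by rewrite /qpoch big_ord_recr. Qed.

Lemma qpoch_neq0 b n : (forall k, b * q ^+ k != 1) -> qpoch b q n != 0.
Proof.
by move=> hb; apply/prodf_neq0 => k _; rewrite subr_eq0 eq_sym hb.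
Qed.

Lemma qpoch_eq0 a N n : a * q ^+ N = 1 -> (N < n)%N -> qpoch a q n = 0.
Proof.
move=> aN Nn; apply/eqP/prodf_eq0; exists (Ordinal Nn) => //=.
by rewrite aN subrr.
Qed.

Hypothesis hqq : forall k, q * q ^+ k != 1.

Lemma qqn_neq0 n : qpoch q q n != 0.
Proof. exact: qpoch_neq0. Qed.

Lemma qbinom0 n : qbinom q n 0 = 1.
Proof. by rewrite /qbinom subn0 qpoch0 mul1r divff // qqn_neq0. Qed.

Lemma qbinomnn n : qbinom q n n = 1.
Proof. by rewrite /qbinom subnn qpoch0 mulr1 divff // qqn_neq0. Qed.

Lemma qbinomS n k : (k < n)%N ->
  qbinom q n.+1 k.+1 = qbinom q n k + q ^+ k.+1 * qbinom q n k.+1.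
Proof.
move=> /subnKC <-; move: (n - k.+1)%N => d.
rewrite /qbinom subSS addSn subSS addKn -addnS addKn addnS !qpochS -!exprS.
have u m : 1 - q ^+ m.+1 != 0 by rewrite subr_eq0 eq_sym exprS.
rewrite [q ^+ (k + d).+2](_ : _ = q ^+ k.+1 * q ^+ d.+1); last first.
  by rewrite -exprD addSn addnS.
move: (u k) (u d) (qqn_neq0 k) (qqn_neq0 d).
move: (q ^+ k.+1) (q ^+ d.+1) (qpoch q q k) (qpoch q q d).
move=> A B C D uA uB hC hD.
by field; rewrite uA uB hC hD.
Qed.

(** The q-Pascal rule, summed against an arbitrary sequence; the boundary values
    of [k] are absorbed here once and for all, because [qbinom q n n.+1] is not
    zero. *)
Lemma qbinom_sum_recl n g :
  \sum_(k < n.+2) qbinom q n.+1 k * g k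
  = \sum_(k < n.+1) qbinom q n k * (g k.+1 + q ^+ k * g k).
Proof.
under [RHS]eq_bigr do rewrite mulrDr.
rewrite big_split /= [X in _ = X + _]big_ord_recr [X in _ = _ + X]big_ord_recl.
rewrite big_ord_recl big_ord_recr /= !qbinom0 !qbinomnn expr0.
rewrite (eq_bigr (fun k : 'I_n => qbinom q n k * g k.+1 +
    qbinom q n k.+1 * (q ^+ k.+1 * g k.+1))) => [|k _]; last first.
  rewrite /bump /= add1n qbinomS // mulrDl; congr (_ + _); ring.
rewrite big_split /= /bump /= add1n.
under [X in _ = _ + (_ + X)]eq_bigr do rewrite add1n.
ring.
Qed.

(** The q-Vandermonde convolution in functional form.  Keeping [g] arbitrary
    makes the induction on [n] a matter of applying the q-Pascal rule on both
    sides. *)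
Lemma qbinom_vandermonde n m g :
  \sum_(k < (n + m).+1) qbinom q (n + m) k * g k
  = \sum_(i < n.+1) \sum_(j < m.+1)
      qbinom q n i * qbinom q m j * q ^+ (j * (n - i)) * g (i + j)%N.
Proof.
elim: n g => [|n IHn] g.
  rewrite big_ord1; apply: eq_bigr => j _.
  by rewrite qbinom0 mul1r muln0 expr0 mulr1.
rewrite addSn qbinom_sum_recl.
rewrite (IHn (fun k => g k.+1 + q ^+ k * g k)).
pose A i := \sum_(j < m.+1) qbinom q m j * q ^+ (j * (n.+1 - i)) * g (i + j)%N.
transitivity (\sum_(i < n.+2) qbinom q n.+1 i * A i); last first.
  apply: eq_bigr => i _; rewrite mulr_sumr; apply: eq_bigr => j _.
  by rewrite !mulrA.
rewrite qbinom_sum_recl; apply: eq_bigr => i _.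
rewrite /A [q ^+ i * _]mulr_sumr -big_split mulr_sumr /=; apply: eq_bigr => j _.
rewrite subSS subSn; last by rewrite -ltnS.
rewrite mulnS !exprD addSn; ring.
Qed.

(** Each factor is reversed: [(1 - q^(k-n)) q^n = - q^k (1 - q^(n-k))]. *)
Lemma qpoch_expV n k : q != 0 -> (k <= n)%N ->
  qpoch (q ^- n) q k * q ^+ (n * k)
  = (-1) ^+ k * q ^+ 'C(k, 2) * (qpoch q q n / qpoch q q (n - k)).
Proof.
move=> q0; elim: k => [_|k IHk kn].
  by rewrite qpoch0 muln0 bin0n !expr0 subn0 divff ?mulr1 // qqn_neq0.
have knE : (n - k)%N = (n - k.+1).+1 by rewrite subnSK.
have := IHk (ltnW kn); rewrite knE !qpochS => IH.
have u : 1 - q * q ^+ (n - k.+1) != 0 by rewrite subr_eq0 eq_sym.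
have qnE : q ^+ n = q ^+ k * (q * q ^+ (n - k.+1)).
  by rewrite -exprS -knE -exprD subnKC // ltnW.
rewrite mulnS exprD.
transitivity ((q ^+ n - q ^+ k) * (qpoch (q ^- n) q k * q ^+ (n * k))).
  by field; exact: expf_neq0.
rewrite IH qnE binS bin1 exprD exprS.
by field; rewrite u qqn_neq0.
Qed.

(** The factor [(q^-n; q)_k] vanishes for [k > n], and for [k <= n] its sign and
    its powers of [q] cancel those of the definition of 2Phi0 and of the
    argument. *)
Lemma qhyper20_qV n w z : q != 0 ->
  qhyper [:: q ^- n; w] [::] q (z * q ^+ n)
  = \sum_(k < n.+1) qbinom q n k * qpoch w q k * z ^+ k.
Proof.
move=> q0; apply: (cvg_lim (@norm_hausdorff _ K)).
have termE k : (k <= n)%N ->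
    qhyper_term [:: q ^- n; w] [::] q (z * q ^+ n) k
    = qbinom q n k * qpoch w q k * z ^+ k.
  move=> kn; rewrite /qhyper_term /qpochs !big_cons !big_nil.
  have -> : (1 + (size [::])%:Z - (size [:: q ^- n; w])%:Z = - 1)%R by [].
  rewrite exprN1 exprMn -exprM mulr1 invr1 mulr1.
  have x0 : (-1) ^+ k * q ^+ 'C(k, 2) != 0.
    by rewrite mulf_neq0 ?expf_neq0 // oppr_eq0 oner_eq0.
  transitivity (((-1) ^+ k * q ^+ 'C(k, 2))^-1 *
      (qpoch (q ^- n) q k * q ^+ (n * k)) * qpoch w q k * z ^+ k / qpoch q q k).
    by ring.
  rewrite qpoch_expV // mulKf // /qbinom.
  by field; rewrite !qqn_neq0.
rewrite (eq_bigr (fun k : 'I_n.+1 =>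
    qhyper_term [:: q ^- n; w] [::] q (z * q ^+ n) k)) => [|k _]; last first.
  by rewrite termE // -ltnS.
apply: cvg_series_finite => k nk.
rewrite /qhyper_term /qpochs !big_cons (qpoch_eq0 (N := n)) //.
  by rewrite !(mul0r, mulr0).
by rewrite mulVf // expf_neq0.
Qed.

End FiniteIdentities.

(** * The terms of the two sides as sums of one triple family *)

Section RogersKernel.
Variables (K : numFieldType) (q : K) (c : nat -> K) (X Y w z : K).

Definition qexp_term z k : K := z ^+ k / qpoch q q k.

(** The triple family whose rearrangement is the theorem; [X], [Y], [w], [z]
    stand for [x t], [x s], [y t], [y s]. *)
Definition rogers_kernel i j l : K :=
  c (i + j)%N * qexp_term X i * qexp_term Y j * q ^+ (j * l) * qexp_term w l.

(** The inner sum is the part that does not involve [m], so that a row is a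
    Cauchy product in [m] with the series of [qexp_term z]. *)
Definition rogers_row n m : K :=
  \sum_(j < m.+1)
    (\sum_(i < n.+1) rogers_kernel i j (n - i)) * qexp_term z (m - j).

Definition rogers_diag n : K :=
  \sum_(i < n.+1)
    c n * qexp_term X i * qexp_term Y (n - i) * qpoch w q (n - i).

End RogersKernel.

Section RogersTerms.
Variables (K : numFieldType) (r : nat) (a : r.+1.-tuple K) (b : r.-tuple K).
Variables (q x y t s : K).
Hypothesis hqq : forall k, q * q ^+ k != 1.

Let c k := qpochs a q k / qpochs b q k.

(** The q-Vandermonde convolution applied to [phi_{n+m}]; the powers of [x],
    [y], [t], [s] and the factorials then separate. *)
Lemma al_salam_carlitz_rogers_row n m :
  al_salam_carlitz a b q (n + m) x y
    * (t ^+ n / qpoch q q n) * (s ^+ m / qpoch q q m)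
  = rogers_row q c (x * t) (x * s) (y * t) (y * s) n m.
Proof.
pose g k := c k * x ^+ k * y ^+ (n + m - k).
have -> : al_salam_carlitz a b q (n + m) x y =
    \sum_(k < (n + m).+1) qbinom q (n + m) k * g k.
  by apply: eq_bigr => k _; rewrite /g !mulrA.
rewrite (qbinom_vandermonde hqq) exchange_big /= !mulr_suml.
apply: eq_bigr => j _; rewrite !mulr_suml; apply: eq_bigr => i _.
have [hi hj] : (i <= n)%N /\ (j <= m)%N by split; rewrite -ltnS.
have yE : y ^+ (n + m - (i + j)) = y ^+ (n - i) * y ^+ (m - j).
  by rewrite -exprD; congr (_ ^+ _); lia.
have tE : t ^+ n = t ^+ i * t ^+ (n - i) by rewrite -exprD subnKC.
have sE : s ^+ m = s ^+ j * s ^+ (m - j) by rewrite -exprD subnKC.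
rewrite /g yE tE sE /rogers_kernel /qexp_term /qbinom !exprMn exprD.
by field; rewrite !qqn_neq0.
Qed.

(** With [k = n - i] in the terminating 2Phi0, [t^n (s/t)^k = t^i s^(n-i)]. *)
Lemma rogers_diag_qhyper n : q != 0 -> t != 0 ->
  qpochs a q n / qpochs (q :: b) q n * (x * t) ^+ n
    * qhyper [:: q ^- n; y * t] [::] q (s * q ^+ n / t)
  = rogers_diag q c (x * t) (x * s) (y * t) n.
Proof.
move=> q0 t0; rewrite [s * _ / t]mulrAC (qhyper20_qV hqq) //.
rewrite mulr_sumr (reindex_inj rev_ord_inj) /=; apply: eq_bigr => i _.
rewrite subSS; have hi : (i <= n)%N by rewrite -ltnS.
rewrite /qbinom subKn //.
have tE : t ^+ n = t ^+ i * t ^+ (n - i) by rewrite -exprD subnKC.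
have xE : x ^+ n = x ^+ i * x ^+ (n - i) by rewrite -exprD subnKC.
rewrite /c /qexp_term /qpochs big_cons !exprMn xE tE exprVn invfM.
have tn0 : t ^+ (n - i) != 0 by rewrite expf_neq0.
move: (\prod_(_ <- b) _)^-1 => B.
by field; rewrite tn0 !qqn_neq0.
Qed.

End RogersTerms.

(** * Tannery's theorem and rearrangement of double series *)

Lemma cvg_sum_seq (K : numFieldType) I (s : seq I) (f : I -> nat -> K)
    (l : I -> K) :
  (forall i, f i @ \oo --> l i) ->
  (fun n => \sum_(i <- s) f i n) @ \oo --> \sum_(i <- s) l i.
Proof.
move=> fl; elim: s => [|i s IHs].
  by under eq_fun do rewrite big_nil; rewrite big_nil; exact: cvg_cst.
under eq_fun do rewrite big_cons.
by rewrite big_cons; apply: cvgD.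
Qed.

Section Tannery.
Variable R : realType.
Implicit Types (u v : nat -> Cplx R) (M : nat -> R).

(** Dominated convergence for series.  The first [K] terms converge to those of
    the limit, and the rest differ by at most twice the tail of [M]; [K] is
    chosen before [n]. *)
Lemma tannery (f : nat -> nat -> Cplx R) (g S : nat -> Cplx R) M (G : Cplx R) :
    (forall n k, cmod (f n k) <= M k) -> cvgn (series M) ->
    (forall k, f n k @[n --> \oo] --> g k) ->
    (forall n, series (f n) @ \oo --> S n) -> series g @ \oo --> G ->
  S @ \oo --> G.
Proof.
move=> fM cM fg fS gG.
have M0 k : 0 <= M k by exact: le_trans (cmod_ge0 _) (fM 0%N k).
have gM k : cmod (g k) <= M k.
  by apply: (cmod_lim_le (N := 0%N) (fg k)) => n _; exact: fM.
pose h n k := cmod (g k - f n k).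
have h2M n k : h n k <= 2 * M k.
  rewrite mulr_natl mulr2n; apply: le_trans (ler_cmodD _ _) _.
  by rewrite cmodN lerD.
(* Uniformly in the truncation index [K]. *)
have key n K : cmod (G - S n) <=
    \sum_(0 <= k < K) h n k + 2 * (limn (series M) - series M K).
  have cfg : series (fun k => g k - f n k) @ \oo --> G - S n.
    rewrite [series _](_ : _ = fun N => series g N - series (f n) N).
      exact: cvgB gG (fS n).
    by apply/funext => N; rewrite /series /= sumrB.
  apply: (cmod_lim_le (N := K) cfg) => N KN.
  apply: le_trans (ler_cmod_sum _ _ _) _.
  rewrite (big_cat_nat (n := K)) //= lerD2l.
  apply: (@le_trans _ _ (\sum_(K <= k < N) 2 * M k)).
    by apply: ler_sum => k _; exact: h2M.
  rewrite -mulr_sumr ler_pM2l // -sub_series_geq // lerD2r.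
  by apply: nondecreasing_cvgn_le => //; exact: nondecreasing_nonneg_series.
apply/cvg_cmodP/cvgr0Pnorm_lt => e e0.
have e4 : 0 < e / 4 by rewrite divr_gt0.
have [K hK] : exists K, limn (series M) - series M K < e / 4.
  have /cvgrPdist_lt/(_ _ e4) [K _ hK] : series M @ \oo --> limn (series M).
    exact: cM.
  exists K; apply: le_lt_trans (ler_norm _) _; exact: (hK K (leqnn K)).
have : (fun n => \sum_(0 <= k < K) h n k) @ \oo --> (0 : R).
  have := @cvg_sum_seq R _ (index_iota 0 K) (fun k n => h n k) (fun=> 0).
  by rewrite big1 //; apply=> k; exact/cvg_cmodP/fg.
move=> /(cvgr0Pnorm_lt (fun n => \sum_(0 <= k < K) h n k))/(_ _ e4).
apply: filterS => n hn.
rewrite ger0_norm ?cmod_ge0 //; apply: le_lt_trans (key n K) _.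
move: hn hK; rewrite ger0_norm; last by apply: sumr_ge0 => k _; exact: cmod_ge0.
lra.
Unshelve. all: by end_near. Qed.

Lemma cvg_seriesMr u (S a : Cplx R) :
  series u @ \oo --> S -> series (fun k => u k * a) @ \oo --> S * a.
Proof.
move=> uS; rewrite [series _](_ : _ = fun n => series u n * a).
  exact: cvgMl.
by apply/funext => n; rewrite /series /= mulr_suml.
Qed.

Lemma cvg_series_sum (I : finType) (f : I -> nat -> Cplx R) (S : I -> Cplx R) :
  (forall i, series (f i) @ \oo --> S i) ->
  series (fun k => \sum_i f i k) @ \oo --> \sum_i S i.
Proof.
move=> fS; rewrite [series _](_ : _ = fun n => \sum_i series (f i) n).
  exact: cvg_sum_seq.
by apply/funext => n; rewrite /series /= exchange_big.
Qed.

(** A triangle summed by antidiagonals is the same triangle summed by rows of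
    decreasing length, which is the form that Tannery's theorem can use. *)
Lemma antidiagonal_partial_sum (v : nat -> nat -> Cplx R) N :
  series (fun n => \sum_(i < n.+1) v i (n - i)%N) N
  = \sum_(i < N) series (v i) (N - i)%N.
Proof.
elim: N => [|N IHN]; first by rewrite /series /= big_geq // big_ord0.
rewrite seriesSr IHN big_ord_recr [RHS]big_ord_recr /= addrA -big_split /=.
have s0 : series (v N) 0%N = 0 by rewrite /series /= big_geq.
rewrite subnn subSnn seriesSr s0 add0r; congr (_ + _).
by apply: eq_bigr => i _; rewrite subSn ?seriesSr // ltnW.
Qed.

(** The [N]-th partial sum over antidiagonals is the sum over [i] of the row
    sums truncated at [N - i]; these tend to the full row sums and are dominated
    by a multiple of [al].  For [v i j = f i * g j] this is the Cauchy
    product. *)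
Lemma antidiagonal_sum (v : nat -> nat -> Cplx R) (al be : nat -> R)
    (r : nat -> Cplx R) :
    (forall i j, cmod (v i j) <= al i * be j) -> (forall i, 0 <= al i) ->
    (forall j, 0 <= be j) -> cvgn (series al) -> cvgn (series be) ->
    (forall i, series (v i) @ \oo --> r i) ->
  exists T : Cplx R, series r @ \oo --> T /\
    series (fun n => \sum_(i < n.+1) v i (n - i)%N) @ \oo --> T.
Proof.
move=> vab al0 be0 cal cbe vr.
pose M i := limn (series be) * al i.
have be_le n : series be n <= limn (series be).
  by apply: nondecreasing_cvgn_le => //; exact: nondecreasing_nonneg_series.
have partialM n i : cmod (series (v i) n) <= M i.
  apply: le_trans (ler_cmod_sum _ _ _) _.
  apply: le_trans (ler_sum _ (fun j _ => vab i j)) _.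
  by rewrite -mulr_sumr /M mulrC; apply: ler_wpM2r => //; exact: be_le.
have cM : cvgn (series M) by apply: is_cvg_seriesZ.
have rM i : cmod (r i) <= M i.
  by apply: (cmod_lim_le (N := 0%N) (vr i)) => n _; exact: partialM.
have /cvg_ex[T rT] := abs_summable_cvg rM cM.
exists T; split => //.
pose f N i := series (v i) (N - i)%N.
apply: (tannery (f := f) (M := M) _ cM _ _ rT) => [N i|i|N].
- exact: partialM.
- by apply: (cvg_comp _ _ _ (vr i)); exact: cvg_subnr.
rewrite antidiagonal_partial_sum; apply: cvg_series_finite => i Ni.
by move: Ni; rewrite /f -subn_eq0 => /eqP ->; rewrite /series /= big_geq.
Qed.

(** Both iterated sums equal the sum over antidiagonals, which is symmetric in
    the two indices. *)
Lemma exchange_sum (v : nat -> nat -> Cplx R) (al be : nat -> R)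
    (r c : nat -> Cplx R) (T : Cplx R) :
    (forall i j, cmod (v i j) <= al i * be j) -> (forall i, 0 <= al i) ->
    (forall j, 0 <= be j) -> cvgn (series al) -> cvgn (series be) ->
    (forall i, series (v i) @ \oo --> r i) ->
    (forall j, series (v^~ j) @ \oo --> c j) ->
  series c @ \oo --> T -> series r @ \oo --> T.
Proof.
move=> vab al0 be0 cal cbe vr vc cT.
have [T1 [rT1 dT1]] := antidiagonal_sum vab al0 be0 cal cbe vr.
have vba j i : cmod (v i j) <= be j * al i by rewrite mulrC.
have [T2 [cT2 dT2]] :=
  antidiagonal_sum (v := fun j i => v i j) vba be0 al0 cbe cal vc.
rewrite (cvg_unique (@norm_hausdorff _ (Cplx R)) cT cT2).
have diagE : (fun n => \sum_(i < n.+1) v (n - i)%N i) =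
             (fun n => \sum_(i < n.+1) v i (n - i)%N).
  apply/funext => n; rewrite (reindex_inj rev_ord_inj) /=.
  by apply: eq_bigr => i _; rewrite subSS subKn // -ltnS.
rewrite diagE in dT2.
by rewrite (cvg_unique (@norm_hausdorff _ (Cplx R)) dT2 dT1).
Qed.

End Tannery.

(** * Bounds on shifted factorials and Euler's q-exponential *)

Section QExponential.
Variables (R : realType) (q : Cplx R).
Hypotheses (hq0 : q != 0) (hq : `|q| < 1).
Implicit Types (u v : nat -> Cplx R) (a b z : Cplx R).

Definition bdd u := exists B : R, forall n, cmod (u n) <= B.

Lemma bddM u v : bdd u -> bdd v -> bdd (fun n => u n * v n).
Proof.
move=> [B uB] [D vD]; exists (B * D) => n.
by rewrite cmodM ler_pM ?cmod_ge0.
Qed.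

Lemma bdd_prod (c : seq (Cplx R)) (f : Cplx R -> nat -> Cplx R) :
  (forall a, a \in c -> bdd (f a)) -> bdd (fun n => \prod_(a <- c) f a n).
Proof.
elim: c => [|a c IHc] fb.
  by exists 1 => n; rewrite big_nil cmod1.
under [fun n => _]eq_fun do rewrite big_cons.
apply: bddM; first by apply: fb; rewrite mem_head.
by apply: IHc => d dc; apply: fb; rewrite inE dc orbT.
Qed.

Lemma cvg_bdd u (l : Cplx R) : u @ \oo --> l -> bdd u.
Proof.
move=> /cvg_cmod ul.
have /cvg_seq_bounded [M [_ hM]] : cvgn (fun n => cmod (u n)).
  by apply/cvg_ex; exists (cmod l).
exists (M + 1) => n; apply: le_trans (ler_norm _) _.
by apply: hM => //; rewrite ltrDl.
Qed.

Lemma cmod_q_gt0 : 0 < cmod q.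
Proof. by rewrite -ltcR -cmodE normr_gt0. Qed.

Lemma cmod_q_lt1 : cmod q < 1.
Proof. by rewrite -cmod_lt1. Qed.

Lemma cvg_expr0 z : cmod z < 1 -> (fun n => z ^+ n) @ \oo --> (0 : Cplx R).
Proof.
move=> z1; apply/cvg_cmodP.
under eq_fun do rewrite sub0r cmodN cmodX.
by apply: cvg_expr; rewrite ger0_norm ?cmod_ge0.
Qed.

(** By [1 + v <= exp v], the products are at most the exponential of a
    convergent geometric series. *)
Lemma bdd_prod_near1 u (A : R) : 0 <= A ->
  (forall k, cmod (u k) <= 1 + A * cmod q ^+ k) ->
  bdd (fun n => \prod_(k < n) u k).
Proof.
move=> A0 uA; have q1 := cmod_q_lt1; have q0 := cmod_q_gt0.
exists (expR (A * (1 - cmod q)^-1)) => n.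
apply: (@le_trans _ _ (expR (A * series (geometric 1 (cmod q)) n))).
  elim: n => [|n IHn].
    by rewrite big_ord0 cmod1 /series /= big_geq // mulr0 expR0.
  rewrite big_ord_recr /= cmodM seriesSr mulrDr expRD ler_pM ?cmod_ge0 //.
  by apply: le_trans (uA n) _; rewrite /= mul1r; exact: expR_ge1Dx.
rewrite ler_expR; apply: ler_wpM2l => //; rewrite -[leRHS]mul1r.
by apply: geometric_le_lim; rewrite ?ger0_norm // ltW.
Qed.

Lemma bdd_qpoch a : bdd (qpoch a q).
Proof.
apply: (@bdd_prod_near1 (fun k => 1 - a * q ^+ k) (cmod a)) => [|k].
  exact: cmod_ge0.
by apply: le_trans (ler_cmodD _ _) _; rewrite cmod1 cmodN cmodM cmodX.
Qed.

(** The inverse factors [w_k = 1 / (1 - b q^k)] tend to 1, so they are bounded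
    by some [D]; then [w_k = 1 + b q^k w_k] puts them in the scope of
    [bdd_prod_near1]. *)
Lemma bdd_qpochV b : (forall k, b * q ^+ k != 1) ->
  bdd (fun n => (qpoch b q n)^-1).
Proof.
move=> hb; pose w k := (1 - b * q ^+ k)^-1.
have w_neq0 k : 1 - b * q ^+ k != 0 by rewrite subr_eq0 eq_sym hb.
have [D wD] : bdd w.
  apply: (@cvg_bdd _ 1^-1); apply: cvgV; first exact: oner_neq0.
  rewrite -[X in _ --> X](subr0 1) -(mulr0 b).
  apply: cvgB; first exact: cvg_cst.
  by apply: cvgMr; apply: cvg_expr0; exact: cmod_q_lt1.
have wE k : w k = 1 + b * q ^+ k * w k.
  by rewrite /w -{2}(mulfV (w_neq0 k)) -mulrDl subrK mul1r.
under [fun n => _]eq_fun do rewrite /qpoch -prodfV.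
apply: (@bdd_prod_near1 w (cmod b * D)) => [|k].
  by rewrite mulr_ge0 ?cmod_ge0 // (le_trans (cmod_ge0 _) (wD 0%N)).
rewrite wE; apply: le_trans (ler_cmodD _ _) _.
rewrite cmod1 lerD2l !cmodM cmodX mulrAC.
apply: ler_wpM2r; first by rewrite exprn_ge0 ?cmod_ge0.
by apply: ler_wpM2l => //; exact: cmod_ge0.
Qed.

Lemma qqk_neq1 k : q * q ^+ k != 1.
Proof.
apply/eqP => /(congr1 (@cmod R)); rewrite -exprS cmodX cmod1 => /eqP.
by rewrite lt_eqF // exprn_ilt1 ?cmod_ge0 ?cmod_q_lt1.
Qed.

Definition qexp z : Cplx R := limn (series (qexp_term q z)).

Lemma qexp_term_bound : exists2 B : R, 0 <= B &
  forall z k, cmod (qexp_term q z k) <= B * cmod z ^+ k.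
Proof.
have [B hB] := bdd_qpochV qqk_neq1.
exists B => [|z k]; first exact: le_trans (cmod_ge0 _) (hB 0%N).
rewrite cmodM cmodX mulrC; apply: ler_wpM2r => //.
by rewrite exprn_ge0 ?cmod_ge0.
Qed.

Lemma is_cvg_geometric_bound (B x : R) : 0 <= x -> x < 1 ->
  cvgn (series (fun k => B * x ^+ k)).
Proof.
by move=> x0 x1; apply: is_cvg_geometric_series; rewrite ger0_norm.
Qed.

Lemma lim_geometric_bound (B x : R) : 0 <= x -> x < 1 ->
  limn (series (fun k => B * x ^+ k)) = B / (1 - x).
Proof.
move=> x0 x1; apply: (cvg_lim (@Rhausdorff R)).
by apply: cvg_geometric_series; rewrite ger0_norm.
Qed.

Lemma cvg_qexp z : cmod z < 1 -> series (qexp_term q z) @ \oo --> qexp z.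
Proof.
move=> z1; have [B B0 hB] := qexp_term_bound.
apply: (abs_summable_cvg (hB z)).
by apply: is_cvg_geometric_bound => //; exact: cmod_ge0.
Qed.

Lemma cmodM_q_lt1 z n : cmod z < 1 -> cmod (z * q ^+ n) < 1.
Proof.
move=> z1; rewrite cmodM cmodX; apply: le_lt_trans z1.
rewrite -[leRHS]mulr1; apply: ler_wpM2l; rewrite ?cmod_ge0 //.
by rewrite exprn_ile1 ?cmod_ge0 // ltW // cmod_q_lt1.
Qed.

(** Telescoping: [e_k(zq) = e_k(z) - z e_{k-1}(z)]. *)
Lemma qexp_qshift z : cmod z < 1 -> qexp (z * q) = (1 - z) * qexp z.
Proof.
move=> z1; have zq1 : cmod (z * q) < 1.
  by have := cmodM_q_lt1 1 z1; rewrite expr1.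
apply: (cvg_lim (@norm_hausdorff _ (Cplx R))).
have partial n : series (qexp_term q (z * q)) n.+1 =
    series (qexp_term q z) n.+1 - z * series (qexp_term q z) n.
  elim: n => [|n IHn].
    rewrite /series /= !big_nat1 big_geq // mulr0 subr0.
    by rewrite /qexp_term !expr0.
  rewrite seriesSr IHn.
  rewrite (seriesSr (qexp_term q z) n.+1) (seriesSr (qexp_term q z) n).
  suff -> : qexp_term q (z * q) n.+1 =
      qexp_term q z n.+1 - z * qexp_term q z n by ring.
  have qn := qqn_neq0 qqk_neq1 n; have qk := qqk_neq1 n.
  rewrite /qexp_term qpochS exprMn !exprS.
  have {}qk : 1 - q * q ^+ n != 0 by rewrite subr_eq0 eq_sym.
  by field; rewrite qn qk.
rewrite -cvg_shiftS; under eq_fun do rewrite partial.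
rewrite mulrBl mul1r; apply: cvgB; first by rewrite cvg_shiftS; exact: cvg_qexp.
by apply: cvgMr; exact: cvg_qexp.
Qed.

Lemma qexp_qshiftn z n : cmod z < 1 -> qexp (z * q ^+ n) = qpoch z q n * qexp z.
Proof.
move=> z1; elim: n => [|n IHn]; first by rewrite expr0 mulr1 qpoch0 mul1r.
rewrite exprSr mulrA.
rewrite qexp_qshift; last exact: cmodM_q_lt1.
rewrite IHn qpochS mulrA.
by congr (_ * _); exact: mulrC.
Qed.

Lemma cvg_qexp_qshiftn z : cmod z < 1 ->
  (fun n => qexp (z * q ^+ n)) @ \oo --> (1 : Cplx R).
Proof.
move=> z1; have [B B0 hB] := qexp_term_bound.
apply: (tannery (f := fun n => qexp_term q (z * q ^+ n))
  (M := fun k => B * cmod z ^+ k) (g := fun k => (k == 0%N)%:R)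
  (S := fun n => qexp (z * q ^+ n))).
- move=> n k; apply: le_trans (hB _ _) _; apply: ler_wpM2l => //.
  apply: lerXn2r; rewrite ?nnegrE ?cmod_ge0 //.
  rewrite cmodM cmodX ler_piMr ?cmod_ge0 //.
  by rewrite exprn_ile1 ?cmod_ge0 // ltW // cmod_q_lt1.
- by apply: is_cvg_geometric_bound => //; exact: cmod_ge0.
- case=> [|k].
    under eq_fun do rewrite /qexp_term expr0 qpoch0 divr1.
    exact: cvg_cst.
  rewrite (_ : (k.+1 == 0%N)%:R = z ^+ k.+1 * 0 / qpoch q q k.+1); last first.
    by rewrite mulr0 mul0r.
  under eq_fun do rewrite /qexp_term exprMn -exprM mulnC exprM.
  apply: cvgMl; apply: cvgMr; apply: cvg_expr0.
  rewrite cmodX exprn_ilt1 ?cmod_ge0 ?cmod_q_lt1 //.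
- by move=> n; apply: cvg_qexp; exact: cmodM_q_lt1.
have := @cvg_series_finite (Cplx R) (fun k => (k == 0%N)%:R) 1.
by rewrite big_ord1; apply; case.
Qed.

(** Since [(z;q)_n E(z) = E(z q^n)] tends to 1, [E(z)] cannot vanish. *)
Lemma qexp_neq0 z : cmod z < 1 -> qexp z != 0.
Proof.
move=> z1; apply/eqP => E0; have := cvg_qexp_qshiftn z1.
under eq_fun do rewrite qexp_qshiftn // E0 mulr0.
move=> /(cvg_unique (@norm_hausdorff _ (Cplx R)) (cvg_cst _)) /eqP.
by rewrite eq_sym oner_eq0.
Qed.

(** Euler's product; the convergence of the infinite product is itself obtained
    from [(z;q)_n = E(z q^n) / E(z)]. *)
Lemma qpoch_infE z : cmod z < 1 -> qpoch_inf z q = (qexp z)^-1.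
Proof.
move=> z1; have E0 := qexp_neq0 z1.
apply: (cvg_lim (@norm_hausdorff _ (Cplx R))).
rewrite -[X in _ --> X]mul1r.
under eq_fun do rewrite -[qpoch z q _](mulfK E0) -qexp_qshiftn //.
by apply: cvgMl; exact: cvg_qexp_qshiftn.
Qed.

End QExponential.

(** * Rearrangement of the triple series *)

Section RogersSummation.
Variables (R : realType) (q : Cplx R).
Hypotheses (hq0 : q != 0) (hq : `|q| < 1).
Variables (c : nat -> Cplx R) (X Y w z : Cplx R).
Hypotheses (hw : cmod w < 1) (hz : cmod z < 1).
Variables (C rho : R).
Hypotheses (hrho0 : 0 <= rho) (hrho1 : rho < 1).
Hypothesis hc : forall i j,
  cmod (c (i + j)%N * X ^+ i * Y ^+ j) <= C * rho ^+ i * rho ^+ j.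

Local Notation kernel := (rogers_kernel q c X Y w).
Local Notation row := (rogers_row q c X Y w z).
Local Notation diag := (rogers_diag q c X Y w).

Lemma rogers_kernel_bound : exists2 D : R, 0 <= D &
  forall i j l, cmod (kernel i j l) <= D * rho ^+ i * rho ^+ j * cmod w ^+ l.
Proof.
have [B hB] := bdd_qpochV hq0 hq (qqk_neq1 hq).
have B0 : 0 <= B by exact: le_trans (cmod_ge0 _) (hB 0%N).
have C0 : 0 <= C.
  have := hc 0 0; rewrite !expr0 !mulr1; exact: le_trans (cmod_ge0 _).
exists (C * (B * B * B)) => [|i j l]; first by rewrite !mulr_ge0.
have -> : kernel i j l = c (i + j)%N * X ^+ i * Y ^+ j *
    ((qpoch q q i)^-1 * (qpoch q q j)^-1 * (qpoch q q l)^-1) * q ^+ (j * l) *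
    w ^+ l.
  by rewrite /rogers_kernel /qexp_term; ring.
have -> : C * (B * B * B) * rho ^+ i * rho ^+ j * cmod w ^+ l =
    C * rho ^+ i * rho ^+ j * (B * B * B) * 1 * cmod w ^+ l by ring.
rewrite cmodM [in leLHS]cmodX; apply: ler_wpM2r.
  by rewrite exprn_ge0 ?cmod_ge0.
rewrite cmodM cmodX; apply: ler_pM; rewrite ?exprn_ge0 ?cmod_ge0 //; last first.
  by rewrite exprn_ile1 ?cmod_ge0 // ltW // cmod_q_lt1.
rewrite cmodM; apply: ler_pM; rewrite ?cmod_ge0 //.
by rewrite !cmodM !ler_pM ?mulr_ge0 ?cmod_ge0.
Qed.

(** The factor [E(z)] comes from the Cauchy product inside each row.  The kernel
    is then summed over [j] and along [i + l = n], or equivalently over [l] and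
    along [i + j = n]; in the second order the sum over [l] is
    [E(w q^j) = (w;q)_j E(w)], and division by [E(w)], which is not zero, gives
    the series of [diag]. *)
Lemma rogers_summation : exists (L : nat -> Cplx R) (T : Cplx R),
  [/\ forall n, series (row n) @ \oo --> L n,
      series L @ \oo --> qexp q w * qexp q z * T &
      series diag @ \oo --> T].
Proof.
have [D D0 uD] := rogers_kernel_bound.
have [B B0 eB] := qexp_term_bound hq0 hq.
have crho (A : R) : cvgn (series (fun k => A * rho ^+ k)).
  exact: is_cvg_geometric_bound.
have cwA (A : R) : cvgn (series (fun k => A * cmod w ^+ k)).
  by apply: is_cvg_geometric_bound; rewrite ?cmod_ge0.
have cz (A : R) : cvgn (series (fun k => A * cmod z ^+ k)).
  by apply: is_cvg_geometric_bound; rewrite ?cmod_ge0.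
have rho_ge0 k : 0 <= rho ^+ k by exact: exprn_ge0.
have w_ge0 k : 0 <= cmod w ^+ k by rewrite exprn_ge0 ?cmod_ge0.
have rho_le1 k : rho ^+ k <= 1 by rewrite exprn_ile1 // ltW.
have w_le1 k : cmod w ^+ k <= 1 by rewrite exprn_ile1 ?cmod_ge0 // ltW.
(* [W i l] is the kernel summed over [j]. *)
pose W i l := limn (series (fun j => kernel i j l)).
have uDj i l j :
    cmod (kernel i j l) <= (D * rho ^+ i * cmod w ^+ l) * rho ^+ j.
  by rewrite [leRHS]mulrAC.
have cW i l : series (fun j => kernel i j l) @ \oo --> W i l.
  exact: abs_summable_cvg (uDj i l) (crho _).
have WD i l :
    cmod (W i l) <= (D / (1 - rho)) * rho ^+ i * (1 * cmod w ^+ l).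
  apply: le_trans (cmod_sum_le (uDj i l) (crho _) (cW i l)) _.
  rewrite lim_geometric_bound // mul1r.
  by rewrite [leRHS](_ : _ = D * rho ^+ i * cmod w ^+ l / (1 - rho)) //; ring.
(* A row is the Cauchy product of [g] with the series of [E(z)]. *)
pose L n := (\sum_(i < n.+1) W i (n - i)%N) * qexp q z.
have cL n : series (row n) @ \oo --> L n.
  pose g j := \sum_(i < n.+1) kernel i j (n - i).
  have gD j : cmod (g j) <= D *+ n.+1 * rho ^+ j.
    apply: le_trans (ler_cmod_sum _ _ _) _.
    rewrite -[X in D *+ X]card_ord mulrnAl -sumr_const; apply: ler_sum => i _.
    apply: le_trans (uD _ _ _) _; rewrite -mulrA.
    rewrite [leRHS](_ : _ = D * 1 * (rho ^+ j * 1)); last by ring.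
    apply: ler_pM; rewrite ?mulr_ge0 //; first by apply: ler_wpM2l.
    by apply: ler_wpM2l.
  pose v j k := g j * qexp_term q z k.
  have vD j k : cmod (v j k) <= (D *+ n.+1 * rho ^+ j) * (B * cmod z ^+ k).
    by rewrite cmodM ler_pM ?cmod_ge0 //; exact: eB.
  have vr j : series (v j) @ \oo --> g j * qexp q z.
    under [v j]eq_fun do rewrite /v mulrC.
    by rewrite mulrC; apply: cvg_seriesMr; exact: cvg_qexp.
  have gL : series g @ \oo --> \sum_(i < n.+1) W i (n - i)%N.
    by apply: cvg_series_sum => i; exact: cW.
  have al0 j : 0 <= D *+ n.+1 * rho ^+ j by rewrite mulr_ge0 ?mulrn_wge0.
  have be0 k : 0 <= B * cmod z ^+ k by rewrite mulr_ge0 // exprn_ge0 ?cmod_ge0.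
  have [T [rT rowT]] := antidiagonal_sum vD al0 be0 (crho _) (cz _) vr.
  have <- : T = L n.
    have rL := @cvg_seriesMr R g _ (qexp q z) gL.
    exact: (cvg_unique (@norm_hausdorff _ (Cplx R)) rT rL).
  exact: rowT.
(* [V i j] is the kernel summed over [l], by [E(w q^j) = (w;q)_j E(w)]. *)
pose p i j := c (i + j)%N * qexp_term q X i * qexp_term q Y j.
pose V i j := p i j * qpoch w q j * qexp q w.
have cV i j : series (fun l => kernel i j l) @ \oo --> V i j.
  have -> : V i j = qexp q (w * q ^+ j) * p i j.
    by rewrite qexp_qshiftn // /V [RHS]mulrC mulrA.
  rewrite [series _](_ : _ = series (fun l =>
      qexp_term q (w * q ^+ j) l * p i j)).
    by apply: cvg_seriesMr; apply: cvg_qexp => //; exact: cmodM_q_lt1.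
  congr series; apply/funext => l.
  by rewrite /rogers_kernel /p /qexp_term exprMn exprM; ring.
have VD i j :
    cmod (V i j) <= (D / (1 - cmod w)) * rho ^+ i * (1 * rho ^+ j).
  apply: le_trans (cmod_sum_le (uD i j) (cwA _) (cV i j)) _.
  rewrite lim_geometric_bound ?cmod_ge0 // mul1r.
  by rewrite [leRHS](_ : _ = D * rho ^+ i * rho ^+ j / (1 - cmod w)) //; ring.
pose S i := limn (series (V i)).
have cS i : series (V i) @ \oo --> S i.
  apply: (abs_summable_cvg (VD i)).
  by under eq_fun do rewrite mulrA; exact: crho.
(* Exchange of the sums over [l] and [j], for fixed [i]. *)
have WS i : series (W i) @ \oo --> S i.
  have uDl l j : cmod (kernel i j l) <=
      (D * rho ^+ i * cmod w ^+ l) * (1 * rho ^+ j).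
    by rewrite mul1r.
  have al0 l : 0 <= D * rho ^+ i * cmod w ^+ l by rewrite !mulr_ge0.
  have be0 j : 0 <= 1 * rho ^+ j by rewrite mul1r.
  exact: exchange_sum uDl al0 be0 (cwA _) (crho _) (cW i) (cV i) (cS i).
have al0 (x : R) k : x < 1 -> 0 <= D / (1 - x) * rho ^+ k.
  by move=> x1; rewrite !mulr_ge0 // invr_ge0 subr_ge0 ltW.
have rho1_ge0 k : 0 <= 1 * rho ^+ k by rewrite mul1r.
have w1_ge0 k : 0 <= 1 * cmod w ^+ k by rewrite mul1r.
(* The antidiagonals [i + l = n] and [i + j = n] lead to the same sum of the
   [S i]. *)
have [T1 [ST1 WT1]] :=
  antidiagonal_sum WD (fun i => al0 _ i hrho1) w1_ge0 (crho _) (cwA _) WS.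
have [T2 [ST2 VT2]] :=
  antidiagonal_sum VD (fun i => al0 _ i hw) rho1_ge0 (crho _) (crho _) cS.
have T12 : T1 = T2 by exact: (cvg_unique (@norm_hausdorff _ (Cplx R)) ST1 ST2).
have E0 := qexp_neq0 hq0 hq hw.
exists L, (T1 / qexp q w); split; first exact: cL.
  have -> : qexp q w * qexp q z * (T1 / qexp q w) = T1 * qexp q z.
    by rewrite mulrAC mulrCA divff // mulr1.
  exact: cvg_seriesMr WT1.
rewrite T12; have VE := @cvg_seriesMr R _ _ (qexp q w)^-1 VT2.
rewrite [series diag](_ : _ = series (fun n =>
    (\sum_(i < n.+1) V i (n - i)%N) / qexp q w)); first exact: VE.
congr series; apply/funext => n; rewrite mulr_suml; apply: eq_bigr => i _.
by rewrite /V /p subnKC ?mulfK // -ltnS.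
Qed.

End RogersSummation.

(** * The Rogers type formula *)

Section RogersFormula.
Variables (R : realType) (r : nat) (a : r.+1.-tuple (Cplx R)).
Variables (b : r.-tuple (Cplx R)) (q x y t s : Cplx R).
Hypotheses (hq0 : q != 0) (hq : `|q| < 1).

Let c k := qpochs a q k / qpochs b q k.

Hypothesis hb : forall (i : 'I_r) (k : nat), tnth b i * q ^+ k != 1.
Hypothesis hx : (`|x * t| < 1 /\ `|x * s| < 1) \/
          (exists (i : 'I_r.+1) (N : nat), tnth a i * q ^+ N = 1).

Lemma bdd_qpochs_ratio : bdd c.
Proof.
apply: bddM.
  by apply: bdd_prod => d _; exact: bdd_qpoch.
under [fun n => _]eq_fun do rewrite /qpochs -prodfV.
apply: (bdd_prod (f := fun d n => (qpoch d q n)^-1)) => d /tnthP[i ->].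
by apply: bdd_qpochV => // k; exact: hb.
Qed.

(** When some [a_i q^N = 1], the ratio vanishes beyond [N], and on [i + j <= N]
    any geometric bound can be reached by enlarging the constant. *)
Lemma qpochs_ratio_geometric_bound : exists (C rho : R), [/\ 0 <= rho, rho < 1 &
  forall i j, cmod (c (i + j)%N * (x * t) ^+ i * (x * s) ^+ j)
              <= C * rho ^+ i * rho ^+ j].
Proof.
have [B cB] := bdd_qpochs_ratio.
have B0 : 0 <= B by exact: le_trans (cmod_ge0 _) (cB 0%N).
case: hx => [[xt1 xs1]|[i0 [N aN]]].
  exists B, (Num.max (cmod (x * t)) (cmod (x * s))).
  rewrite !cmod_lt1 in xt1 xs1; split.
  - by rewrite le_max cmod_ge0.
  - by rewrite gt_max xt1 xs1.
  move=> i j; rewrite 2!cmodM !cmodX.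
  apply: ler_pM; rewrite ?mulr_ge0 ?exprn_ge0 ?cmod_ge0 //; last first.
    by apply: lerXn2r; rewrite ?nnegrE ?le_max ?cmod_ge0 ?lexx ?orbT.
  apply: ler_pM; rewrite ?exprn_ge0 ?cmod_ge0 //.
  by apply: lerXn2r; rewrite ?nnegrE ?le_max ?cmod_ge0 ?lexx ?orbT.
pose M := 1 + cmod (x * t) + cmod (x * s).
have [xt0 xs0] := (cmod_ge0 (x * t), cmod_ge0 (x * s)).
have M1 : 1 <= 2 * M by rewrite /M; lra.
have M0 : 0 <= M by rewrite /M; lra.
(* [M^(i+j) = (2 M)^(i+j) / 2^(i+j)] and [1 <= 2 M], [i + j <= N]. *)
exists (B * (2 * M) ^+ N), 2^-1; split => [||i j]; [lra|lra|].
have [ijN|Nij] := leqP (i + j) N; last first.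
  rewrite /c (_ : qpochs a q _ = 0).
    by rewrite !mul0r cmod0 !mulr_ge0 ?exprn_ge0 // mulr_ge0.
  apply/eqP; rewrite /qpochs prodf_seq_eq0; apply/hasP.
  by exists (tnth a i0); rewrite ?mem_tnth //= (qpoch_eq0 aN).
rewrite 2!cmodM !cmodX.
apply: (@le_trans _ _ (B * M ^+ i * M ^+ j)).
  apply: ler_pM; rewrite ?mulr_ge0 ?exprn_ge0 ?cmod_ge0 //; last first.
    by apply: lerXn2r; rewrite ?nnegrE ?cmod_ge0 // /M; lra.
  apply: ler_pM; rewrite ?exprn_ge0 ?cmod_ge0 //.
  by apply: lerXn2r; rewrite ?nnegrE ?cmod_ge0 // /M; lra.
rewrite -!mulrA; apply: ler_wpM2l => //; rewrite -!exprD.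
apply: (@le_trans _ _ ((2 * M) ^+ (i + j) * 2^-1 ^+ (i + j))).
  by rewrite -exprMn mulrAC mulfV ?mul1r.
apply: ler_wpM2r; first by rewrite exprn_ge0.
exact: ler_weXn2l.
Qed.

End RogersFormula.

Theorem theorem4 (R : realType) (r : nat) (a : r.+1.-tuple (Cplx R))
    (b : r.-tuple (Cplx R)) (q x y t s : Cplx R)
    (* the expressions are defined *)
    (hq0 : q != 0) (ht0 : t != 0)
    (hb : forall (i : 'I_r) (k : nat), tnth b i * q ^+ k != 1)
    (hq : `|q| < 1)
    (hyt : `|y * t| < 1) (hys : `|y * s| < 1)
    (* the series converge: |xt|, |xs| < 1, or they terminate in x *)
    (hx : (`|x * t| < 1 /\ `|x * s| < 1) \/
          (exists (i : 'I_r.+1) (N : nat), tnth a i * q ^+ N = 1)) :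
  let F (n m : nat) : Cplx R :=
    al_salam_carlitz a b q (n + m) x y
    * (t ^+ n / qpoch q q n) * (s ^+ m / qpoch q q m) in
  let G (n : nat) : Cplx R :=
    qpochs a q n / qpochs (q :: b) q n * (x * t) ^+ n
    * qhyper [:: q ^- n; y * t] [::] q (s * q ^+ n / t) in
  [/\ forall n, cvgn (series (F n)),
      cvgn (series (fun n => limn (series (F n)))),
      cvgn (series G) &
      limn (series (fun n => limn (series (F n)))) =
        (qpochs_inf [:: y * t; y * s] q)^-1 * limn (series G)].
Proof.
move=> F G.
have [C [rho [rho0 rho1 hc]]] := qpochs_ratio_geometric_bound hq0 hq hb hx.
have [hw hz] : cmod (y * t) < 1 /\ cmod (y * s) < 1 by rewrite -!cmod_lt1.
pose c k := qpochs a q k / qpochs b q k.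
have [L [T [FL LT GT]]] := rogers_summation (c := c) hq0 hq hw hz rho0 rho1 hc.
have FE n : F n = rogers_row q c (x * t) (x * s) (y * t) (y * s) n.
  by apply/funext => m; apply: al_salam_carlitz_rogers_row; exact: qqk_neq1.
have GE : G = rogers_diag q c (x * t) (x * s) (y * t).
  by apply/funext => n; apply: rogers_diag_qhyper => //; exact: qqk_neq1.
have limF : (fun n => limn (series (F n))) = L.
  apply/funext => n; rewrite FE.
  exact: (cvg_lim (@norm_hausdorff _ (Cplx R)) (FL n)).
rewrite limF GE; split.
- by move=> n; rewrite FE; apply/cvg_ex; exists (L n); exact: FL.
- by apply/cvg_ex; exists (qexp q (y * t) * qexp q (y * s) * T); exact: LT.
- by apply/cvg_ex; exists T; exact: GT.
rewrite (cvg_lim (@norm_hausdorff _ (Cplx R)) LT).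
rewrite (cvg_lim (@norm_hausdorff _ (Cplx R)) GT).
rewrite /qpochs_inf !big_cons big_nil mulr1 !qpoch_infE //.
by rewrite -invfM invrK.
Qed.
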